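(* (In ZFC.) There exists a filter $\mathcal{F}$ on a countably infinite set $D$ such that $\mathcal{F}$ is Hurewicz, $\mathcal{F}$ has character $\mathfrak{b}$, and $\mathcal{F}$ is not an $F_\sigma$ subset of $\mathcal{P}(D)$.
   Context: A filter on a set $D$ is a family $\mathcal{F}\subset\mathcal{P}(D)$ with $\emptyset\notin\mathcal{F}$, closed under intersections of two elements and under supersets in $D$. All filters are assumed to live on a countably infinite set $D$ and to contain all cofinite subsets of $D$. $\mathcal{P}(D)$ carries the Cantor set topology obtained by identifying it with ${}^{D}2$ via characteristic functions, and a filter has the subspace topology. A base of $\mathcal{F}$ is a subset $\mathcal{B}\subset\mathcal{F}$ such that every $x\in\mathcal{F}$ contains some $y\in\mathcal{B}$; the character of $\mathcal{F}$ is the least cardinality of a base of $\mathcal{F}$. A space $X$ is Hurewicz if for every sequence $(\mathcal{U}_n)_{n<\omega}$ of open covers of $X$ there are finite $\mathcal{V}_n\subset\mathcal{U}_n$ such that every $x\in X$ belongs to $\bigcup\mathcal{V}_n$ for all but finitely many $n$. For $f,g\in{}^{\omega}\omega$, $f\leq^\ast g$ means $f(n)\leq g(n)$ for all but finitely many $n$. The cardinal $\mathfrak{b}$ is the least cardinality of a subset of ${}^{\omega}\omega$ with no $\leq^\ast$-upper bound in ${}^{\omega}\omega$. *)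

(* Defs.v *)
From HB Require Import structures.
From mathcomp Require Import all_boot all_classical topology.

Set Implicit Arguments.
Unset Strict Implicit.
Unset Printing Implicit Defensive.

Local Open Scope classical_set_scope.
Local Open Scope card_scope.

(** [prod_topology] over the discrete space [bool] is the Cantor space of
    characteristic functions; [powerset_space D] is [set D] with that topology
    pulled back, so that subsets of [powerset_space D] are also set systems
    on [D]. *)
Definition charfun (D : Type) (A : set D) : prod_topology (fun _ : D => bool) :=
  fun d => d \in A.

Definition powerset_space (D : Type) : Type := initial_topology (@charfun D).

HB.instance Definition _ (D : Type) :=
  Topological.copy (powerset_space D) (initial_topology (@charfun D)).

Definition hurewicz_space (X : topologicalType) : Prop :=
  forall U : nat -> set (set X),
    (forall n, U n `<=` open /\ \bigcup_(A in U n) A = [set: X]) ->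
    exists V : nat -> set (set X),
      (forall n, V n `<=` U n /\ finite_set (V n)) /\
      forall x : X, \forall n \near \oo, (\bigcup_(A in V n) A) x.

Definition base_of_filter (D : Type) (F B : set_system D) : Prop :=
  B `<=` F /\ forall x, F x -> exists2 y, B y & y `<=` x.

(** Cardinals are represented by sets up to [#=]: [K] has the least cardinality
    of a set satisfying [P]. *)
Definition least_cardinality (T U : Type) (P : set (set T)) (K : set U) : Prop :=
  (exists2 A, P A & A #= K) /\ forall A, P A -> K #<= A.

Definition has_character (D U : Type) (F : set_system D) (K : set U) : Prop :=
  least_cardinality (base_of_filter F) K.

Definition eventually_le (f g : nat -> nat) : Prop :=
  \forall n \near \oo, (f n <= g n)%N.

Definition unbounded_family (G : set (nat -> nat)) : Prop :=
  ~ exists g, forall f, G f -> eventually_le f g.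

Definition has_cardinality_b (U : Type) (K : set U) : Prop :=
  least_cardinality unbounded_family K.

(* Main.v *)
Require Import Defs.
From mathcomp Require Import all_boot all_classical topology borel_hierarchy.

Local Open Scope classical_set_scope.
Local Open Scope card_scope.

(** The filter lives on the tree of finite sequences of natural numbers and
    comes from a scale [X]: an unbounded set of functions such that, for every
    [x] in [X], fewer than b members of [X] fail to dominate [x] eventually.
    Such a set of size b is built by transfinite recursion.  Writing [branch f]
    for the set of finite initial segments of [f], the filter is dual to the
    ideal generated by the finite sets and the branches of the members of [X].

    Character.  A finite union of branches almost contains only the branches it
    is made of.  Hence any member [B] of the filter determines a function
    dominating all [f] whose branch misses [B]; the functions obtained from a
    base dominate [X], so a base has at least b elements.  Conversely the finite
    subsets of [X] give a base, and there are b of them because a set which is a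
    union of b sets of size less than b injects into [X].

    Hurewicz property.  By the Lindelof property the covers are sequences
    [u n i], and one has to bound, eventually in [n], the first [i] with
    [B] in [u n i].  The argument is an induction on the number [k] of branches
    of [X] outside a fixed finite set [T] needed to cover the complement of [B].
    The sets [approx T j k N] are closed, decrease with [N], and their
    intersection lies in the filter, so by compactness some [approx T j k N] is
    covered by [u n 0], ..., [u n N].  This gives [N] as a function of [n] and
    [j], hence one function [g] almost bounding all of them.  Take [x] in [X]
    not dominated by [g].  If all the [k] functions lie above [x], infinitely
    many [j] with [g j < x j] serve all of them simultaneously and yield a bound
    not depending on them.  Otherwise one of the functions is among the fewer
    than b members of [X] not above [x]; moving it to [T] lowers [k], and fewer
    than b bounds have a common bound.

    Not F-sigma.  The map sending [f] to the complement of its branch turns an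
    F-sigma presentation of the filter into countably many pieces of [X], one of
    which is unbounded.  A Cantor scheme of nodes above which this piece stays
    unbounded produces a perfect set of functions below a single [g].  By
    closedness it is contained in [X].  Since some [x] in [X] is not dominated
    by [g], no element of the perfect set dominates [x], so the perfect set has
    fewer than b elements; but it has the size of the continuum, which is at
    least b. *)

(** * Domination and sets of size less than b *)

Lemma eventually_le_refl f : eventually_le f f.
Proof. exact: nearW. Qed.

Lemma eventually_le_trans g f h :
  eventually_le f g -> eventually_le g h -> eventually_le f h.
Proof. by move=> fg gh; near=> n; apply: (@leq_trans (g n)); near: n.
Unshelve. all: by end_near. Qed.

Definition dominated (G : set (nat -> nat)) :=
  exists g, forall f, G f -> eventually_le f g.

Lemma dominated_sub (G H : set (nat -> nat)) :
  G `<=` H -> dominated H -> dominated G.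
Proof. by move=> GH [g Hg]; exists g => f /GH /Hg. Qed.

Lemma not_dominated_exists (G : set (nat -> nat)) (g : nat -> nat) :
  ~ dominated G -> exists2 f, G f & ~ eventually_le f g.
Proof.
move=> ndG; apply: contrapT => nG; apply: ndG; exists g => f Gf.
by apply: contrapT => nfg; apply: nG; exists f.
Qed.

Lemma not_dominatedT : ~ dominated [set: nat -> nat].
Proof.
move=> [g /(_ (fun n => (g n).+1) I) [N _ /(_ N)]] /=.
by rewrite leqnn ltnn => /(_ isT).
Qed.

Lemma dominated_range (h : nat -> nat -> nat) : dominated (range h).
Proof.
exists (fun n => \max_(i < n.+1) h i n) => _ [i _ <-].
exists i => //= n /= lein.
exact: (leq_bigmax (Ordinal (lein : i < n.+1)%N)).
Qed.

(** This is |A| < b: the images of [A] are, up to choice, the families of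
    functions of size at most |A|.  In this form closure under unions and finite
    sequences needs no cardinal arithmetic. *)
Definition small {I : Type} (A : set I) :=
  forall h : I -> nat -> nat, dominated (h @` A).

Lemma small_sub {I : Type} (A B : set I) : A `<=` B -> small B -> small A.
Proof. by move=> AB sB h; apply: dominated_sub (sB h); exact: image_subset. Qed.

Lemma small_image {I J : Type} (f : I -> J) (A : set I) :
  small A -> small (f @` A).
Proof. by move=> sA h; rewrite image_comp; exact: sA. Qed.

Lemma small_inj {I J : Type} (f : I -> J) (A : set I) :
  {in A &, injective f} -> small (f @` A) -> small A.
Proof.
move=> finj sfA h.
have [->|/set0P[a0 Aa0]] := eqVneq A set0.
  by exists id => _ [? []].
pose k y : I := xget (a0 : {classic I}) (A `&` [set a | f a = y]).
have [g gP] := sfA (h \o k).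
exists g => _ [a Aa <-]; apply: gP; exists (f a); first by exists a.
have [Ak fk] : (A `&` [set b | f b = f a]) (k (f a)).
  by apply: (@xgetPex {classic I} a0); exists a.
by rewrite /= (finj _ _ _ _ fk) ?inE.
Qed.

(** Regularity of b: dominate each piece first, then the dominating functions. *)
Lemma small_bigcup {I J : Type} (A : set I) (F : I -> set J) :
  small A -> (forall i, A i -> small (F i)) -> small (\bigcup_(i in A) F i).
Proof.
move=> sA sF h.
have /choice[g gP] : forall i, exists g, A i ->
    forall j, F i j -> eventually_le (h j) g.
  move=> i; have [Ai|nAi] := pselect (A i); last by exists id.
  by have [g gP] := sF i Ai h; exists g => _ j Fj; apply: gP; exists j.
have [G GP] := sA g.
exists G => _ [j [i Ai Fj] <-].
by apply: eventually_le_trans (gP i Ai j Fj) (GP _ _); exists i.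
Qed.

Lemma small_countable {I : Type} (A : set I) : countable A -> small A.
Proof.
move=> /countable_injP[f] finj; apply: (@small_inj _ _ f).
  exact: finj.
by move=> h; apply: dominated_sub (dominated_range h); exact: image_subset.
Qed.

Lemma small1 {I : Type} (i : I) : small [set i].
Proof. exact/small_countable/countable1. Qed.

Lemma small_setU {I : Type} (A B : set I) : small A -> small B -> small (A `|` B).
Proof.
move=> sA sB.
rewrite (_ : A `|` B = \bigcup_(b in [set: bool]) (if b then A else B)).
  by apply: small_bigcup => [|[]//]; exact: small_countable.
apply/seteqP; split=> [x []|x [[] _]]; [by exists true|by exists false|by left|by right].
Qed.

Lemma small_seq {I : eqType} (A : set I) :
  small A -> small [set s : seq I | forall i, i \in s -> A i].
Proof.
move=> sA.
pose F n := [set s : seq I | size s = n /\ forall i, i \in s -> A i].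
apply: (@small_sub _ _ (\bigcup_n F n)); first by move=> s sP; exists (size s).
apply: small_bigcup => [|n _]; first exact: small_countable.
elim: n => [|n IHn].
  by apply: small_sub (small1 [::]) => s [/size0nil].
apply: (@small_sub _ _ (\bigcup_(i in A) (cons i @` F n))).
  move=> [[]//|i s] [[ss] sP]; exists i; first by apply: sP; rewrite mem_head.
  by exists s => //; split=> // j js; apply: sP; rewrite inE js orbT.
by apply: small_bigcup => // i _; exact: small_image.
Qed.

(** * Construction of a scale *)

(** Transfinite recursion in which the value at [i] is only constrained by its
    relation to the earlier values taken one at a time. *)
Lemma greedy_choice {I : Type} {Y : choiceType} (y0 : Y) (R : I -> I -> Prop)
    (C : I -> Y -> Prop) (Q : Y -> Y -> Prop) : well_founded R ->
  (forall i (h : I -> Y), exists y, C i y /\ forall j, R j i -> Q (h j) y) ->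
  exists h : I -> Y, forall i, C i (h i) /\ forall j, R j i -> Q (h j) (h i).
Proof.
move=> wfR step.
pose body i (rec : forall j, R j i -> Y) :=
  xget y0 [set y | C i y /\ forall j (r : R j i), Q (rec j r) y].
pose h := Fix wfR (fun=> Y) body.
have hE i : h i = body i (fun j _ => h j).
  rewrite /h Fix_eq // => k f g fg; rewrite /body.
  congr (xget _ _); apply/seteqP; split=> y [Cy Qy]; split=> // j r.
    by rewrite -fg.
  by rewrite fg.
exists h => i; rewrite hE; have [y yP] := step i h.
by apply: (@xgetPex _ y0 [set y | C i y /\ forall j (r : R j i), Q (h j) y]); exists y.
Qed.

Lemma well_order_exists (I : Type) : exists R : I -> I -> Prop,
  well_founded R /\ forall i j, [\/ R i j, i = j | R j i].
Proof.
have [r wor] := wochoice.well_ordering_principle {classic I}.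
have tot i j : r i j || r j i.
  have [|k [[+ kP] _]] := wor [pred k | (k == i) || (k == j)].
    by exists i; rewrite inE eqxx.
  by rewrite inE => /orP[]/eqP E; rewrite -[in X in _ || X]E -?[in X in X || _]E
    ?kP ?orbT // inE eqxx ?orbT.
exists (fun i j => r i j /\ i <> j); split; last first.
  move=> i j; have [->|nij] := pselect (i = j); first by constructor 2.
  by have /orP[rij|rji] := tot i j; [constructor 1|constructor 3; split=> // /esym].
move=> i; apply: contrapT => nAcc.
have [|k [[+ kP] _]] := wor [pred k | `[< ~ Acc (fun i j => r i j /\ i <> j) k >]].
  by exists i; rewrite inE.
rewrite inE => /=; apply; constructor=> j [rjk njk].
apply: contrapT => nAccj.
have rkj : r k j by apply: kP; rewrite inE.
have [|m [_ mU]] := wor [pred l | (l == k) || (l == j)].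
  by exists k; rewrite inE eqxx.
(* [j] and [k] are both least elements of the pair they form *)
have rr l : r l l by have := tot l l; rewrite orbb.
apply: njk; rewrite -(mU k) ?(mU j) //; split; rewrite ?inE ?eqxx ?orbT //;
  by move=> l; rewrite inE => /orP[]/eqP->.
Qed.

Lemma inj_on_card_le {I J : Type} (f : I -> J) (A : set I) (B : set J) :
  {in A &, injective f} -> f @` A `<=` B -> A #<= B.
Proof.
move=> finj fAB; apply: card_le_trans (subset_card_le fAB).
by have /card_esym := inj_card_eq finj; rewrite card_eq_le => /andP[].
Qed.

(** An index set for a scale: the shortest initial segment of a well-order of
    all functions that is not small. *)
Lemma scale_index : exists (L : choiceType) (R : L -> L -> Prop),
  [/\ well_founded R, forall k l, [\/ R k l, k = l | R l k],
      forall l, small [set k | R k l] & ~ small [set: L]].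
Proof.
have [R [wfR totR]] := well_order_exists (nat -> nat).
have nsT : ~ small [set: nat -> nat].
  by move=> /(_ id); rewrite image_id; exact: not_dominatedT.
have [allS|] := pselect (forall l, small [set k | R k l]).
  by exists {classic nat -> nat}, R.
move=> /existsNP[l0]; elim/(well_founded_ind wfR): l0 => l IH nsl.
have [[m ml nsm]|segS] := pselect (exists2 m, R m l & ~ small [set k | R k m]).
  exact: IH nsm.
pose W : set {classic nat -> nat} := [set k | R k l].
exists W, (fun i j => R (val i) (val j)); split.
- suff H k : forall w : W, val w = k -> Acc (fun i j : W => R (val i) (val j)) w.
    by move=> w; exact: (H (val w)).
  elim/(well_founded_ind wfR): k => k IHk w wk; constructor=> v Rvw.
  by apply: (IHk (val v)) => //; rewrite -wk.
- move=> i j; have [|/val_inj|] := totR (val i) (val j);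
    by [constructor 1|constructor 2|constructor 3].
- move=> i; apply: (@small_inj _ _ (val : W -> _)) => [? ? _ _ /val_inj//|].
  have : small [set k | R k (val i)].
    by apply: contrapT => nsi; apply: segS; exists (val i) => //; exact: (set_valP i).
  by apply: small_sub => _ [k Rk <-].
- move=> sW; apply: nsl; apply: small_sub (small_image (val : W -> _) _ sW).
  by move=> k Rk; exists (SigSub (mem_set (Rk : W k))).
Qed.

Section Index.
Context {L : choiceType} {R : L -> L -> Prop}.
Hypothesis wfR : well_founded R.
Hypothesis totR : forall k l, [\/ R k l, k = l | R l k].
Hypothesis segS : forall l, small [set k | R k l].
Hypothesis bigL : ~ small [set: L].

Lemma wf_total_trans j k l : R j k -> R k l -> R j l.
Proof.
move=> Rjk Rkl; have [//|jl|Rlj] := totR j l; exfalso.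
  suff : forall a b, R a b -> R b a -> False by move=> /(_ j k Rjk); apply; rewrite jl.
  move=> a; elim/(well_founded_ind wfR): a => a IH b Rab Rba.
  exact: (IH b Rba a).
suff : forall a b c, R a b -> R b c -> R c a -> False by move=> /(_ j k l); apply.
move=> a; elim/(well_founded_ind wfR): a => a IH b c Rab Rbc Rca.
exact: (IH c Rca a b).
Qed.

(** Injectivity is obtained greedily along a lexicographic order on [A], first
    by an index [l] of a piece [F l], then arbitrarily: fewer than b values are
    forbidden at each step, so [B] is never exhausted. *)
Lemma card_le_big {Z Y : Type} (A : set Z) (F : L -> set Z) (B : set Y) :
    (forall l, small (F l)) -> A `<=` \bigcup_l F l -> ~ small B ->
  A #<= B.
Proof.
move=> sF AF bigB.
have [y0 By0] : B !=set0.
  by apply/set0P/eqP => B0; apply: bigB; rewrite B0; exact: small_countable.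
have [RZ [wfRZ totRZ]] := well_order_exists Z.
have /choice[r rF] : forall z, exists l, A z -> F l z.
  move=> z; have [/AF[l _ Fz]|nAz] := pselect (A z); first by exists l.
  have [l _] : [set: L] !=set0.
    by apply/set0P/eqP => L0; apply: bigL; rewrite L0; exact: small_countable.
  by exists l.
(* [r z] is the index of a piece containing [z] *)
pose S z' z := A z' /\ (R (r z') (r z) \/ r z' = r z /\ RZ z' z).
have wfS : well_founded S.
  suff H l : forall z, r z = l -> Acc S z by move=> z; exact: (H (r z)).
  elim/(well_founded_ind wfR): l => l IHl z.
  elim/(well_founded_ind wfRZ): z => z IHz rz.
  constructor=> z' [_ [Rz|[rzz RZz]]]; first by apply: (IHl (r z')) => //; rewrite -rz.
  by apply: IHz => //; rewrite rzz.
have [h hP] : exists h : Z -> {classic Y}, forall z, B (h z) /\ forall z', S z' z -> h z' <> h z.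
  apply: (@greedy_choice _ {classic Y} y0 S (fun _ y => B y) (fun y y' => y <> y') wfS).
  move=> z h; apply: contrapT => noy; apply: bigB.
  apply: (@small_sub _ _ (h @` [set z' | S z' z])).
    move=> y By; apply: contrapT => ny; apply: noy; exists y; split=> // z' Sz' hz'.
    by apply: ny; exists z'.
  apply: small_image.
  apply: (@small_sub _ _ (\bigcup_(l in [set k | R k (r z)] `|` [set r z]) F l)).
    move=> z' [Az' [Rz'|[rz' _]]]; exists (r z'); [by left|exact: rF|by right|exact: rF].
  by apply: small_bigcup => //; apply: small_setU; [exact: segS|exact: small1].
apply: (@inj_on_card_le _ _ h); last by move=> _ [z _ <-]; have [] := hP z.
move=> z z' /set_mem Az /set_mem Az' hzz'; apply: contrapT => nzz'.
have [] : S z z' \/ S z' z.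
  have [?|rr|?] := totR (r z) (r z'); [by left; split=> //; left| |by right; split=> //; left].
  by have [?|//|?] := totRZ z z'; [left|right]; split=> //; right.
  by move=> Szz; exact: (proj2 (hP z') z Szz hzz').
by move=> Szz; exact: (proj2 (hP z) z' Szz (esym hzz')).
Qed.

(** Only fewer than b functions precede [x l], so [x l] can be chosen above all
    of them and above [e l]. *)
Lemma dominating_scale (e : L -> nat -> nat) : exists x : L -> nat -> nat,
  forall l, eventually_le (e l) (x l) /\ forall k, R k l -> eventually_le (x k) (x l).
Proof.
apply: (@greedy_choice _ (nat -> nat) id R (fun l y => eventually_le (e l) y) eventually_le wfR).
move=> l h; have [g gP] := segS l h.
exists (fun n => maxn (e l n) (g n)); split; first by apply: nearW => n; exact: leq_maxl.
move=> j Rjl; apply: (eventually_le_trans g); first by apply: gP; exists j.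
by apply: nearW => n; exact: leq_maxr.
Qed.

End Index.

(** The second condition says that the members of [X] not above [x] form a
    set of size less than b. *)
Definition scale (X : set (nat -> nat)) :=
  ~ dominated X /\ forall x, X x -> small [set f | X f /\ ~ eventually_le x f].

Lemma not_dominated_big (A : set (nat -> nat)) : ~ dominated A -> ~ small A.
Proof. by move=> nA /(_ id); rewrite image_id. Qed.

Lemma small_prod_countable {I : Type} {C : countType} (A : set I) :
  small A -> small [set p : I * C | A p.1].
Proof.
move=> sA.
apply: (@small_sub _ _ (\bigcup_(c in [set: C]) ((fun i => (i, c)) @` A))).
  by move=> [i c] /= Ai; exists c => //; exists i.
apply: small_bigcup => [|c _]; last exact: small_image.
by apply: small_countable; exact: countableP.
Qed.

(** The last two conclusions give |X| = b and the count of finite subsets of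
    [X] that the base of the filter requires; both come from the greedy
    embedding, the second one because the finite sequences below a given index
    form a small set. *)
Lemma scale_exists : exists X : set (nat -> nat),
  [/\ scale X, forall A : set (nat -> nat), ~ dominated A -> X #<= A &
    forall C : countType,
      [set p : seq (nat -> nat) * C | forall f, f \in p.1 -> X f] #<= X].
Proof.
have [L [R [wfR totR segS bigL]]] := scale_index.
have /existsNP[e ne] := bigL.
have [x xP] := dominating_scale wfR segS e.
have ndX : ~ dominated (range x).
  move=> [g gP]; apply: ne; exists g => _ [l _ <-].
  by apply: (eventually_le_trans (x l)); [have [] := xP l|apply: gP; exists l].
exists (range x); split.
- split=> // _ [l _ <-]; apply: (@small_sub _ _ (x @` [set k | R k l])).
    move=> _ [[k _ <-] nxk]; exists k => //=.
    have [//|kl|Rlk] := totR k l; exfalso; apply: nxk.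
      by rewrite kl; exact: eventually_le_refl.
    by have [_] := xP k; apply.
  exact: small_image.
- move=> A ndA; apply: (card_le_big wfR totR segS bigL _ (fun l => [set x l])).
  + by move=> l; exact: small1.
  + by move=> _ [l _ <-]; exists l.
  + exact: not_dominated_big.
move=> C.
pose W l := x @` ([set k | R k l] `|` [set l]).
apply: (card_le_big wfR totR segS bigL _
  (fun l => [set p : seq (nat -> nat) * C | forall f, f \in p.1 -> W l f])).
- move=> l; apply: (@small_prod_countable _ _ [set s | forall f, f \in s -> W l f]).
  by apply/small_seq/small_image/small_setU; [exact: segS|exact: small1].
- move=> [s c] /= sX.
  (* a finite sequence of members of [X] has a largest index *)
  suff [l lP] : exists l, forall f, f \in s -> W l f by exists l.
  elim: s sX => [|f s IHs] sX.
    have [l _] : [set: L] !=set0; last by exists l.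
    by apply/set0P/eqP => L0; apply: bigL; rewrite L0; exact: small_countable.
  have [|l lP] := IHs; first by move=> g gs; apply: sX; rewrite inE gs orbT.
  have [k _ xk] : range x f by apply: sX; rewrite mem_head.
  have WS i j : (R i j \/ i = j) -> W i `<=` W j.
    move=> [Rij|->//] _ [m mi <-]; exists m => //; left.
    by case: mi => [Rmi|->//]; exact: (wf_total_trans wfR totR _ _ _ Rmi Rij).
  have Wkf : W k f by exists k => //; right.
  have [Rkl|kl|Rlk] := totR k l.
  - exists l => g; rewrite inE => /orP[/eqP->|/lP//]; apply: (WS k) => //; by left.
  - exists l => g; rewrite inE => /orP[/eqP->|/lP//]; by rewrite -kl.
  - exists k => g; rewrite inE => /orP[/eqP->//|/lP]; apply: WS; by left.
- exact: not_dominated_big.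
Qed.

(** * The Cantor space of subsets *)

Lemma charfun_surj (D : Type) : @charfun D @` setT = setT.
Proof.
apply/seteqP; split=> // f _; exists [set d | f d] => //.
by apply/funext => d; apply/idP/idP => [/set_mem|/mem_set].
Qed.

Lemma powerset_compact (D : eqType) : compact [set: powerset_space D].
Proof.
have cpt : compact [set: prod_topology (fun _ : D => bool)].
  have := @tychonoff D (fun=> bool) (fun=> setT) (fun=> bool_compact).
  by congr (compact _); apply/seteqP.
rewrite compact_ultra => F FU _.
have FU' : UltraFilter [set (@charfun D) @` A | A in F].
  exact: ultra_image (charfun_surj D).
move: cpt; rewrite compact_ultra => /(_ _ FU')[|f [_ fP]].
  by exists setT; [exact: filterT|exact: charfun_surj].
have [A _ Af] : (@charfun D @` setT) f by rewrite charfun_surj.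
exists A; split=> //=.
by apply/cvg_image; [exact: charfun_surj|rewrite Af].
Qed.

Lemma continuous_mem (D : eqType) (d : D) :
  continuous (fun A : powerset_space D => d \in (A : set D)).
Proof.
move=> A; apply: (@continuous_comp (powerset_space D)
  (prod_topology (fun _ : D => bool)) bool (@charfun D) (@proj D (fun=> bool) d)).
  exact: initial_continuous.
exact: proj_continuous.
Qed.

Lemma closed_membership (D : eqType) (d : D) (b : bool) :
  closed [set A : powerset_space D | (d \in (A : set D)) = b].
Proof.
have /continuous_closedP/(_ [set b]) := continuous_mem _ d.
by apply; exact: discrete_closed.
Qed.

Lemma closed_has_mem (D : eqType) (s : seq D) :
  closed [set A : powerset_space D | has (fun d => d \in (A : set D)) s].
Proof.
elim: s => [|d s IHs].
  by rewrite (_ : mkset _ = set0); [exact: closed0|apply/seteqP; split].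
rewrite (_ : mkset _ = [set A : powerset_space D | (d \in (A : set D)) = true] `|`
    [set A : powerset_space D | has (fun d => d \in (A : set D)) s]).
  by apply: closedU => //; exact: closed_membership.
by apply/seteqP; split=> A /= => [/orP//|/orP].
Qed.

Lemma compact_nested_closed (X : topologicalType) (C : nat -> set X) :
  compact [set: X] -> (forall n, closed (C n)) ->
  (forall m n, (m <= n)%N -> C n `<=` C m) -> \bigcap_n C n = set0 ->
  exists n, C n = set0.
Proof.
move=> cptX clC decC C0; apply: contrapT => nC.
have /choice[a aC] : forall n, exists x, C n x.
  by move=> n; apply/set0P/eqP => Cn0; apply: nC; exists n.
have [p [_ pP]] := cptX (a @ \oo) _ filterT.
have : (\bigcap_n C n) p; last by rewrite C0.
move=> n _; apply: clC => B Bp.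
have [|x [Cx Bx]] := pP (C n) B _ Bp; last by exists x.
by exists n => // m /= nm; exact: decC nm _ (aC m).
Qed.

(** The first [m] bits of the characteristic function of [A], with a dummy bit at
    the numbers that encode no point. *)
Definition trace {D : countType} (m : nat) (A : set D) : seq bool :=
  mkseq (fun i => if unpickle i is Some d then d \in A else false) m.

Lemma traceP {D : countType} (m : nat) (A B : set D) d :
  trace m A = trace m B -> (pickle d < m)%N -> (d \in A) = (d \in B).
Proof.
move=> E dm; have := congr1 (fun s => nth false s (pickle d)) E.
by rewrite !nth_mkseq // !pickleK.
Qed.

Lemma eq_trace {D : countType} (m : nat) (A B : set D) :
  (forall i d, (i < m)%N -> unpickle i = Some d -> (d \in A) = (d \in B)) ->
  trace m A = trace m B.
Proof.
move=> AB; apply/eq_in_map => i; rewrite mem_iota => /andP[_ im].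
by case E : (unpickle i) => [d|//]; exact: AB im E.
Qed.

(** The basic neighbourhoods are determined by finitely many points.  The sets
    agreeing with [A] on the first [m] points shrink to [A] alone, so by
    compactness they end up inside [O]. *)
Lemma open_trace (D : countType) (O : set (powerset_space D)) (A : powerset_space D) :
  open O -> O A -> exists m, forall B : powerset_space D,
    trace m (B : set D) = trace m (A : set D) -> O B.
Proof.
move=> oO OA.
pose C m := [set B : powerset_space D | forall d, (pickle d < m)%N ->
  (d \in (B : set D)) = (d \in (A : set D))] `&` ~` O.
have [||||m Cm] := @compact_nested_closed (powerset_space D) C.
- exact: powerset_compact.
- move=> n; apply: closedI; last exact: open_closedC.
  rewrite (_ : mkset _ = \bigcap_(d in [set d | (pickle d < n)%N])
    [set B : powerset_space D | (d \in (B : set D)) = (d \in (A : set D))]) //.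
  by apply: closed_bigI => d _; exact: closed_membership.
- by move=> m n mn B [BA nO]; split=> // d dm; apply: BA; exact: leq_trans mn.
- apply/seteqP; split=> // B BC; have [_] := BC 0 I; apply.
  suff -> : B = A by [].
  apply/seteqP; split=> d; have [/(_ d (ltnSn _)) E _] := BC (pickle d).+1 I.
    by move=> /mem_set; rewrite E => /set_mem.
  by move=> /mem_set; rewrite -E => /set_mem.
exists m => B BA; apply: contrapT => nOB.
have : C m B by split=> // d; exact: traceP.
by rewrite Cm.
Qed.

(** Choose one member of [U] for each finite trace that forces a set into some
    member of [U]. *)
Lemma lindelof_powerset (D : countType) (F : set (powerset_space D))
    (U : set (set (powerset_space D))) :
  F !=set0 -> U `<=` open -> F `<=` \bigcup_(O in U) O ->
  exists u : nat -> set (powerset_space D),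
    (forall i, U (u i)) /\ F `<=` \bigcup_i u i.
Proof.
move=> [A0 FA0] oU FU.
have [O0 UO0 _] := FU A0 FA0.
have /choice[o oP] : forall c : seq bool, exists O, U O /\
    forall O', U O' -> (forall B : powerset_space D, trace (size c) (B : set D) = c -> O' B) ->
    (forall B : powerset_space D, trace (size c) (B : set D) = c -> O B).
  move=> c; have [[O' [UO' O'c]]|nO'] := pselect (exists O', U O' /\
      forall B : powerset_space D, trace (size c) (B : set D) = c -> O' B).
    by exists O'.
  by exists O0; split=> // O' UO' O'c; exfalso; apply: nO'; exists O'.
exists (fun i => if unpickle i is Some c then o c else O0); split.
  by move=> i; case: unpickle => // c; have [] := oP c.
move=> A FA; have [O UO OA] := FU A FA.
have [m mP] := open_trace _ _ _ (oU _ UO) OA.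
have sz B : size (trace m (B : set D)) = m by rewrite size_mkseq.
exists (pickle (trace m (A : set D))) => //; rewrite pickleK.
by apply: (proj2 (oP _) O UO) => [B|]; rewrite sz // => /mP.
Qed.

(** * The filter generated by a set of branches *)

Definition branch (f : nat -> nat) : set (seq nat) := range (mkseq f).

Definition spine (s : seq (nat -> nat)) : set (seq nat) :=
  \bigcup_(f in [set f | f \in s]) branch f.

Definition branch_filter (X : set (nat -> nat)) : set_system (seq nat) :=
  [set B | exists2 s : seq (nat -> nat),
    (forall f, f \in s -> X f) & finite_set (~` B `\` spine s)].

Lemma branchP f t : branch f t <-> t = mkseq f (size t).
Proof.
split=> [[n _ <-]|->]; last by exists (size t).
by rewrite size_mkseq.
Qed.

Lemma spine_sub s s' : {subset s <= s'} -> spine s `<=` spine s'.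
Proof. by move=> ss t [f /= fs ft]; exists f => //=; exact: ss. Qed.

Lemma mkseq_inj (f : nat -> nat) : injective (mkseq f).
Proof. by move=> m n /(congr1 size); rewrite !size_mkseq. Qed.

Lemma eventually_all_in (I : eqType) (s : seq I) (P : I -> nat -> Prop) :
  (forall i, i \in s -> \forall n \near \oo, P i n) ->
  \forall n \near \oo, forall i, i \in s -> P i n.
Proof.
elim: s => [|i s IHs] sP; first exact: nearW.
near=> n => j; rewrite inE => /orP[/eqP->|].
  by near: n; apply: sP; rewrite mem_head.
by move: j; near: n; apply: IHs => j js; apply: sP; rewrite inE js orbT.
Unshelve. all: by end_near. Qed.

(** Different branches have only finitely many common nodes.  This property of
    the tree is what lets a set in the ideal remember the functions it came
    from. *)
Lemma branch_almost_sub_spine f s :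
  finite_set (branch f `\` spine s) -> f \in s.
Proof.
move=> fin; apply: contrapT => /negP fs.
have [N _ NP] : \forall n \near \oo, forall g, g \in s -> mkseq f n <> mkseq g n.
  apply: eventually_all_in => g gs.
  have /existsNP[n fgn] : ~ forall n, f n = g n.
    by move=> /funext fg; move: fs; rewrite fg gs.
  exists n.+1 => //= m nm /(congr1 (fun t => nth 0 t n)).
  by rewrite !nth_mkseq.
move: fin; apply/infiniteP.
apply: (@inj_on_card_le _ _ (fun n => mkseq f (n + N))).
  by move=> m n _ _ /mkseq_inj /addIn.
move=> _ [n _ <-]; split; first by exists (n + N).
move=> [g /= gs /branchP]; rewrite size_mkseq; apply: NP => //=.
exact: leq_addl.
Qed.

Lemma branch_filter_proper X : ProperFilter (branch_filter X).
Proof.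
split.
  move=> [s _]; rewrite setC0 => fin.
  (* every function would belong to the finite set [s] *)
  have [g gP] := dominated_range (nth id s).
  apply: (@not_dominatedT); exists g => f _.
  have fs : f \in s.
    by apply: branch_almost_sub_spine; apply: sub_finite_set fin => t [].
  by apply: gP; exists (index f s) => //; exact: nth_index.
split.
- by exists [::] => //; rewrite setCT set0D; exact: finite_set0.
- move=> A B [s sX sA] [s' s'X s'B]; exists (s ++ s').
    by move=> f; rewrite mem_cat => /orP[/sX|/s'X].
  apply: (@sub_finite_set _ _ ((~` A `\` spine s) `|` (~` B `\` spine s'))).
    move=> t [+ nt]; rewrite setCI => -[nA|nB]; [left|right]; split=> //;
      apply: contra_not nt; apply: spine_sub => f; rewrite mem_cat => ->;
      by rewrite ?orbT.
  by rewrite finite_setU.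
- move=> A B AB [s sX sA]; exists s => //; apply: sub_finite_set sA.
  by move=> t [nBt nst]; split=> // /AB.
Qed.

Lemma frechet_branch_filter X : @frechet_filter (seq nat) `<=` branch_filter X.
Proof.
by move=> A finA; exists [::] => //; apply: sub_finite_set finA => t [].
Qed.

Lemma branch_filterC X f : X f <-> branch_filter X (~` branch f).
Proof.
split=> [Xf|[s sX]].
  exists [:: f]; first by move=> g; rewrite inE => /eqP->.
  apply: sub_finite_set (finite_set0 _) => t [/contrapT ft nt].
  by apply: nt; exists f; rewrite /= ?inE.
by rewrite setCK => /branch_almost_sub_spine/sX.
Qed.

Lemma branch_filter_dominates X B : branch_filter X B ->
  exists g, forall f, branch f `<=` ~` B -> eventually_le f g.
Proof.
move=> [s sX fin]; have [g gP] := dominated_range (nth id s).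
exists g => f fB; apply: gP; exists (index f s) => //; apply: nth_index.
by apply: branch_almost_sub_spine; apply: sub_finite_set fin; exact: setSD.
Qed.

(** For the lower bound, a base would otherwise yield fewer than b functions
    dominating [X]; the upper bound counts pairs of a finite sequence in [X] and
    a finite set of nodes. *)
Lemma branch_filter_character X : ~ dominated X ->
  (forall A : set (nat -> nat), ~ dominated A -> X #<= A) ->
  (forall C : countType,
     [set p : seq (nat -> nat) * C | forall f, f \in p.1 -> X f] #<= X) ->
  has_character (branch_filter X) X.
Proof.
move=> ndX leX seqX.
have lower (B : set_system (seq nat)) : base_of_filter (branch_filter X) B -> X #<= B.
  move=> [BF Bbase].
  have /choice[g gP] : forall b : set (seq nat), exists g, B b ->
      forall f, branch f `<=` ~` b -> eventually_le f g.
    move=> b; have [/BF/branch_filter_dominates[g gP]|nB] := pselect (B b); last by exists id.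
    by exists g.
  apply: card_le_trans (card_image_le g B); apply: leX => -[h hP]; apply: ndX.
  exists h => f /branch_filterC/Bbase[b Bb bf].
  apply: (eventually_le_trans (g b)); last by apply: hP; exists b.
  by apply: gP => // t ft /bf.
split=> //.
pose base (p : seq (nat -> nat) * seq (seq nat)) := ~` (spine p.1 `|` [set` p.2]).
pose I := [set p : seq (nat -> nat) * seq (seq nat) | forall f, f \in p.1 -> X f].
have baseP : base_of_filter (branch_filter X) (base @` I).
  split=> [_ [[s t] /= sX <-]|A [s sX /finite_seqP[t tE]]].
    exists s => //; apply: (@sub_finite_set _ _ [set` t]); last exact: finite_seq.
    by move=> d [/contrapT[]].
  exists (base (s, t)); first by exists (s, t).
  move=> d /not_orP[/= nds ndt]; apply: contrapT => nAd; apply: ndt.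
  by rewrite -[_ (d \in t)]/([set` t] d) -tE.
exists (base @` I) => //; apply/card_eqPle; split; last exact: lower.
exact: card_le_trans (card_image_le _ _) (seqX _).
Qed.

(** * The Hurewicz property *)

(** Once the covers are enumerated, a function [h] replaces the finite
    subfamilies, so that solutions for different parts of the space can be merged
    by eventual domination. *)
Definition cover_bounded {P : Type} (u : nat -> nat -> set P) (Z : set P) :=
  exists h : nat -> nat, forall B, Z B ->
    \forall n \near \oo, exists2 i, (i <= h n)%N & u n i B.

Lemma cover_bounded_sub {P : Type} (u : nat -> nat -> set P) (Y Z : set P) :
  Y `<=` Z -> cover_bounded u Z -> cover_bounded u Y.
Proof. by move=> YZ [h hP]; exists h => B /YZ /hP. Qed.

(** Fewer than b bounding functions have a common bound. *)
Lemma cover_bounded_bigcup {P I : Type} (u : nat -> nat -> set P) (A : set I)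
    (Z : I -> set P) :
  small A -> (forall a, A a -> cover_bounded u (Z a)) ->
  cover_bounded u (\bigcup_(a in A) Z a).
Proof.
move=> sA Zb.
have /choice[h hP] : forall a, exists h : nat -> nat, A a -> forall B, Z a B ->
    \forall n \near \oo, exists2 i, (i <= h n)%N & u n i B.
  move=> a; have [/Zb[h hP]|nAa] := pselect (A a); last by exists id.
  by exists h.
have [g gP] := sA h.
exists g => B [a Aa ZB].
have hg : eventually_le (h a) g by apply: gP; exists a.
apply: filterS2 hg (hP a Aa B ZB) => n hgn [i ih uB].
by exists i => //; exact: leq_trans hgn.
Qed.

Section Hurewicz.
Local Notation P := (powerset_space (seq nat)).

Definition trunk (s : seq (nat -> nat)) (j : nat) : set (seq nat) :=
  spine s `|` [set t | (pickle t < j)%N].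

(** A closed set containing the sets whose complement is covered by [T], the
    first [j] nodes and [k] branches of functions taking values at least [N] at
    [j].  Being covered by [k] branches is relaxed to missing at most [k] nodes
    on each level, a conjunction of conditions on finitely many nodes each. *)
Definition approx (T : seq (nat -> nat)) (j k N : nat) : set P :=
  [set B : P |
    (forall t, ~ trunk T j t -> (j < size t)%N -> (nth 0 t j < N)%N ->
      (t \in (B : set (seq nat))) = true) /\
    (forall l (s : seq (seq nat)), uniq s -> size s = k.+1 ->
      (forall t, t \in s -> size t = l /\ ~ trunk T j t) ->
      has (fun t => t \in (B : set (seq nat))) s)].

Lemma closed_approx T j k N : closed (approx T j k N).
Proof.
rewrite (_ : approx T j k N =
  \bigcap_(t in [set t | [/\ ~ trunk T j t, (j < size t)%N & (nth 0 t j < N)%N]])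
     [set B : P | (t \in (B : set (seq nat))) = true] `&`
  \bigcap_(s in [set s : seq (seq nat) | [/\ uniq s, size s = k.+1 &
     exists l, forall t, t \in s -> size t = l /\ ~ trunk T j t]])
     [set B : P | has (fun t => t \in (B : set (seq nat))) s]).
  by apply: closedI; apply: closed_bigI => t _; [exact: closed_membership|exact: closed_has_mem].
apply/seteqP; split=> B [B1 B2]; split.
- by move=> t [? ? ?]; exact: B1.
- by move=> s [? ? [l ?]]; exact: (B2 l).
- by move=> t ? ? ?; apply: B1; split.
- by move=> l s ? ? ?; apply: B2; split=> //; exists l.
Qed.

Lemma approx_anti T j k M N : (M <= N)%N -> approx T j k N `<=` approx T j k M.
Proof.
by move=> MN B [B1 B2]; split=> // t nt jt tM; apply: B1 => //; exact: leq_trans MN.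
Qed.

(** Outside the trunk no node of length more than [j] is missing from [B], since
    its value at [j] would have to exceed every [N]; the remaining levels are
    finitely many and miss at most [k] nodes each. *)
Lemma bigcap_approx (X : set (nat -> nat)) (T : seq (nat -> nat)) j k :
  (forall f, f \in T -> X f) ->
  \bigcap_N approx T j k N `<=` (branch_filter X : set P).
Proof.
move=> TX B BP; exists T => //.
pose lev l := [set t : seq nat | [/\ size t = l, ~ trunk T j t & ~ (B : set _) t]].
have fin_lev l : finite_set (lev l).
  apply: contrapT => /(@infinite_set_fset (seq nat) _ k.+1)[s sl sk].
  have [_ Bl] := BP 0 I.
  have : has (fun t => t \in (B : set (seq nat))) (take k.+1 (finmap.enum_fset s)).
    apply: (Bl l); first exact/take_uniq/finmap.fset_uniq.
      by rewrite size_takel.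
    by move=> t /mem_take/sl[].
  by move=> /hasP[t /mem_take/sl[_ _ nB] /set_mem].
apply: (@sub_finite_set _ _ (\bigcup_(l in `I_j.+1) lev l `|` [set t | (pickle t < j)%N])).
  move=> t [nBt nst]; have [tj|tj] := ltnP (pickle t) j; first by right.
  have ntr : ~ trunk T j t by case=> //=; rewrite ltnNge tj.
  left; exists (size t) => //=; rewrite ltnS leqNgt; apply/negP => jt.
  by have [/(_ t ntr jt (ltnSn _)) /set_mem] := BP (nth 0 t j).+1 I.
rewrite finite_setU; split; first exact: bigcup_finite.
apply: (@card_le_finite _ _ _ `I_j) => //.
by apply: (@inj_on_card_le _ _ pickle) => [? ? _ _ /(pcan_inj pickleK)//|_ [t tj <-]].
Qed.

(** A single bound serves both for the parameter and for the index in the cover: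
    compactness is applied to the part of [approx T j k N] outside
    [u 0], ..., [u N]. *)
Lemma approx_sub_cover (X : set (nat -> nat)) (T : seq (nat -> nat)) j k (u : nat -> set P) :
  (forall f, f \in T -> X f) -> (forall i, open (u i)) ->
  (branch_filter X : set P) `<=` \bigcup_i u i ->
  exists N, approx T j k N `<=` [set B | exists2 i, (i <= N)%N & u i B].
Proof.
move=> TX uo Xu.
pose C N := approx T j k N `&` ~` \bigcup_(i in `I_N.+1) u i.
have [||||N CN] := @compact_nested_closed P C.
- exact: powerset_compact.
- move=> n; apply: closedI; first exact: closed_approx.
  by apply: open_closedC; apply: bigcup_open.
- move=> m n mn B [/(approx_anti _ _ _ _ _ mn) Bm nB]; split=> // -[i /= im uB].
  by apply: nB; exists i => //=; exact: leq_trans mn.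
- apply/seteqP; split=> // B BC.
  have [|i _ uB] := Xu B; first by apply: (bigcap_approx X T j k TX) => N _; have [] := BC N I.
  by have [_] := BC i I; apply; exists i => /=.
exists N => B BN; apply: contrapT => nB.
suff : C N B by rewrite CN.
by split=> // -[i /= iN uB]; apply: nB; exists i.
Qed.

Lemma approx_branch_filter T S j k N (B : P) :
  (size S <= k)%N -> (forall f, f \in S -> (N <= f j)%N) ->
  (~` (B : set (seq nat)) `\` spine (S ++ T)) `<=` [set t | (pickle t < j)%N] ->
  approx T j k N B.
Proof.
move=> Sk SN BS.
have out t : ~ trunk T j t -> t \notin (B : set (seq nat)) ->
    exists2 f, f \in S & t = mkseq f (size t).
  move=> ntr /negP nB; apply: contrapT => nS; apply: ntr.
  have [|nst] := pselect (spine T t); first by left.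
  right; apply: BS; split; first by move=> /mem_set.
  move=> [f /=]; rewrite mem_cat => /orP[fS /branchP ft|fT ft]; last by apply: nst; exists f.
  by apply: nS; exists f.
split=> [t ntr jt tN|l s us sk sl].
  apply/negP => /negP /(out t ntr)[f fS ft].
  by move: tN; rewrite ft nth_mkseq // ltnNge SN.
apply/negP => /negP /hasPn nB.
suff : (size s <= size [seq mkseq f l | f <- S])%N.
  by rewrite size_map sk leqNgt ltnS Sk.
apply: uniq_leq_size => // t ts; have [tl ntr] := sl t ts.
have [f fS ->] := out t ntr (nB t ts).
by rewrite tl; exact: map_f.
Qed.

Variable X : set (nat -> nat).
Hypothesis scaleX : scale X.
Variable u : nat -> nat -> set P.
Hypothesis open_u : forall n i, open (u n i).
Hypothesis cover_u : forall n, (branch_filter X : set P) `<=` \bigcup_i u n i.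

(** The sets used in the induction on [k]: up to finitely many nodes, the
    complement is covered by [T] and [k] more branches. *)
Definition stage (T : seq (nat -> nat)) (k : nat) : set P :=
  [set B : P | exists S : seq (nat -> nat), [/\ forall f, f \in S -> X f,
     (size S <= k)%N & finite_set (~` (B : set (seq nat)) `\` spine (S ++ T))]].

(** The functions above [x] are all large at the same places, namely at almost
    every [j] with [g j < x j], so one [j] serves the [k] of them at once.  These
    places are infinite in number but need not be cofinite, hence the bound at
    [n] is read off at some such [nx n] beyond [n]. *)
Lemma stage_above_bounded T k : (forall f, f \in T -> X f) ->
  exists2 x, X x & cover_bounded u
    [set B : P | exists S : seq (nat -> nat), [/\ forall f, f \in S -> eventually_le x f,
     (size S <= k)%N & finite_set (~` (B : set (seq nat)) `\` spine (S ++ T))]].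
Proof.
move=> TX.
have /choice[N NP] : forall nj : nat * nat, exists N,
    approx T nj.2 k N `<=` [set B | exists2 i, (i <= N)%N & u nj.1 i B].
  by move=> [n j]; exact: (approx_sub_cover X).
have [g gP] := dominated_range (fun n j => N (n, j)).
have [x Xx nxg] := not_dominated_exists X g (proj1 scaleX).
exists x => //.
(* [g] dominates each row of [N] only from some place on, whence [J] *)
have /choice[nx nxP] : forall n, exists j, [/\ (n <= j)%N, (N (n, j) <= g j)%N & (g j < x j)%N].
  move=> n; have [J _ JP] : eventually_le (fun j => N (n, j)) g by apply: gP; exists n.
  apply: contrapT => nj; apply: nxg; exists (maxn n J) => // j /=.
  rewrite geq_max => /andP[le_nj le_Jj]; rewrite leqNgt; apply/negP => gx.
  by apply: nj; exists j; split=> //; exact: JP.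
exists (fun n => N (n, nx n)) => B [S [SP Sk /finite_seqP[t tE]]].
have [M _ MP] : \forall j \near \oo, forall f, f \in S -> (x j <= f j)%N.
  exact: eventually_all_in.
exists (maxn M (\max_(d <- t) (pickle d).+1)) => // n /=.
rewrite geq_max => /andP[Mn tn]; have [nle gN gx] := nxP n.
apply: (NP (n, nx n)); apply: (approx_branch_filter _ S) => //=.
  move=> f fS; apply: leq_trans gN _; apply: leq_trans (ltnW gx) _.
  by apply: MP => //=; exact: leq_trans nle.
rewrite tE => d /= dt; apply: leq_trans nle; apply: leq_trans tn.
exact: (@leq_bigmax_seq _ t xpredT (fun d => (pickle d).+1) d dt).
Qed.

(** Members of a stage that involve a function not above [x] are absorbed into
    fewer than b stages with one function fewer, that function joining [T]. *)
Lemma stage_bounded k T : (forall f, f \in T -> X f) -> cover_bounded u (stage T k).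
Proof.
elim: k T => [|k IHk] T TX.
  have [x Xx] := stage_above_bounded T 0 TX; apply: cover_bounded_sub => B.
  move=> [S [SX]]; rewrite leqn0 => /nilP-> fin.
  by exists [::].
have [x Xx core] := stage_above_bounded T k.+1 TX.
set C := mkset _ in core.
pose tail := [set f | X f /\ ~ eventually_le x f].
have tailb : cover_bounded u (\bigcup_(f in tail) stage (f :: T) k).
  apply: cover_bounded_bigcup; first exact: (proj2 scaleX).
  move=> f [Xf _]; apply: IHk => g; rewrite inE => /orP[/eqP->//|]; exact: TX.
apply: (@cover_bounded_sub _ _ _ (\bigcup_(b in [set: bool])
    (if b then C else \bigcup_(f in tail) stage (f :: T) k))); last first.
  by apply: cover_bounded_bigcup => [|[]//]; apply: small_countable.
move=> B [S [SX Sk fin]].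
have [Sx|/existsNP[f /not_implyP[fS nxf]]] :=
    pselect (forall f, f \in S -> eventually_le x f).
  by exists true => //; exists S.
exists false => //; exists f; first by split=> //; exact: SX.
(* [f] passes from [S] to [T] *)
exists (rem f S); split=> [g /mem_rem/SX//||].
  by rewrite size_rem // -subn1 leq_subLR add1n.
apply: sub_finite_set fin; apply: setDS; apply: spine_sub => g.
rewrite !mem_cat inE => /orP[gS|->]; last by rewrite !orbT.
have := perm_mem (perm_to_rem fS) g; rewrite gS inE => /esym/orP[->|->//].
by rewrite orbT.
Qed.

Lemma branch_filter_cover_bounded : cover_bounded u (branch_filter X : set P).
Proof.
apply: (@cover_bounded_sub _ _ _ (\bigcup_(k in [set: nat]) stage [::] k)).
  by move=> B [s sX fin]; exists (size s) => //; exists s; rewrite cats0.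
by apply: cover_bounded_bigcup => [|k _]; [exact: small_countable|exact: stage_bounded].
Qed.

End Hurewicz.

(** Relatively open covers are traces of families of open sets, which may be
    assumed countable. *)
Lemma branch_filter_hurewicz X : scale X ->
  hurewicz_space (set_type (branch_filter X : set (powerset_space (seq nat)))).
Proof.
set F : set (powerset_space (seq nat)) := branch_filter X.
move=> scaleX U Ucov.
pose U' n := [set O : set (powerset_space (seq nat)) |
  open O /\ U n ((val : F -> _) @^-1` O)].
have F0 : F !=set0 by exists setT; exact: (@filterT _ _ (branch_filter_proper X)).
have /choice[u uP] : forall n, exists u : nat -> set (powerset_space (seq nat)),
    (forall i, U' n (u i)) /\ F `<=` \bigcup_i u i.
  move=> n; apply: lindelof_powerset => //; first by move=> O [].
  move=> B FB; have [oU covU] := Ucov n.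
  have : [set: F] (SigSub (mem_set FB)) by [].
  rewrite -covU => -[A UA AB]; have [O oO OA] := oU A UA.
  by exists O; [split=> //; rewrite OA|move: AB; rewrite -OA].
have [h hP] : cover_bounded u F.
  apply: branch_filter_cover_bounded => // n;
    by [move=> i; have [/(_ i)[]] := uP n|have [] := uP n].
exists (fun n => (fun i => (val : F -> _) @^-1` u n i) @` `I_(h n).+1).
split=> [n|B].
  split; last exact: finite_image.
  by move=> _ [i _ <-]; have [/(_ i)[]] := uP n.
apply: filterS (hP _ (set_valP B)) => n [i ih uB].
by exists ((val : F -> _) @^-1` u n i) => //; exists i.
Qed.

(** * The filter is not F-sigma *)

Lemma dominated_bigcup {C : countType} (A : C -> set (nat -> nat)) :
  (forall c, dominated (A c)) -> dominated (\bigcup_c A c).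
Proof.
move=> /choice[g gP].
have [h hP] := dominated_range (fun i => if unpickle i is Some c then g c else id).
exists h => f [c _ Af]; apply: (eventually_le_trans (g c)); first exact: gP.
by apply: hP; exists (pickle c) => //; rewrite pickleK.
Qed.

Lemma dominated1 f : dominated [set f].
Proof. by exists f => _ ->; exact: eventually_le_refl. Qed.

Lemma eq_mkseqP (f g : nat -> nat) n :
  mkseq f n = mkseq g n <-> forall i, (i < n)%N -> f i = g i.
Proof.
split=> [E i ilt|E]; last by apply/eq_in_map => i; rewrite mem_iota => /E.
by have := congr1 (fun s => nth 0 s i) E; rewrite !nth_mkseq.
Qed.

Lemma eq_mkseq_le (f g : nat -> nat) m n : (m <= n)%N ->
  mkseq f n = mkseq g n -> mkseq f m = mkseq g m.
Proof.
by move=> mn /eq_mkseqP E; apply/eq_mkseqP => i im; apply: E; exact: leq_trans mn.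
Qed.

(** The analogue of the condensation points of [Z], with the dominated sets as
    negligible sets. *)
Definition dominated_kernel (Z : set (nat -> nat)) : set (nat -> nat) :=
  [set z | forall n, ~ dominated (Z `&` [set f | mkseq f n = mkseq z n])].

(** The points of [Z] outside the kernel are covered by countably many dominated
    sets, one for each node, so the kernel cannot have fewer than two points. *)
Lemma dominated_kernel_split Z : ~ dominated Z -> exists z z',
  [/\ dominated_kernel Z z, dominated_kernel Z z' & z <> z'].
Proof.
move=> ndZ; apply: contrapT => nzz.
have [z0 z0P] : exists z0, dominated_kernel Z `<=` [set z0].
  have [->|/set0P[z0 Kz0]] := eqVneq (dominated_kernel Z) set0; first by exists id.
  by exists z0 => z Kz; apply: contrapT => zz0; apply: nzz; exists z, z0.
apply: ndZ.
(* [None] stands for the piece consisting of the only kernel point *)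
pose A (c : option (seq nat)) := if c is Some t then
  (if `[< dominated (Z `&` [set f | mkseq f (size t) = t]) >]
   then Z `&` [set f | mkseq f (size t) = t] else set0) else [set z0].
apply: (@dominated_sub _ (\bigcup_c A c)); last first.
  apply: dominated_bigcup => -[t|] /=; last exact: dominated1.
  by case: asboolP => //; exists id.
move=> f Zf; have [/z0P ->|] := pselect (dominated_kernel Z f); first by exists None.
move=> /existsNP[n /contrapT dn]; exists (Some (mkseq f n)) => //=.
by rewrite size_mkseq asboolT.
Qed.

Lemma dominated_kernel_sub Y Z : Y `<=` Z -> dominated_kernel Y `<=` dominated_kernel Z.
Proof.
move=> YZ z Kz n; apply: contra_not (Kz n); apply: dominated_sub; exact: setSI.
Qed.

Lemma dominated_kernel_next Z z n : dominated_kernel Z z ->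
  exists z' n', [/\ dominated_kernel Z z', mkseq z' n = mkseq z n, (n < n')%N &
    mkseq z' n' <> mkseq z n'].
Proof.
move=> Kz.
have near_z y : dominated_kernel (Z `&` [set f | mkseq f n = mkseq z n]) y ->
    dominated_kernel Z y /\ mkseq y n = mkseq z n.
  move=> Ky; split; first by move: Ky; apply: dominated_kernel_sub; exact: subIsetl.
  apply: contrapT => yz; apply: (Ky n); exists id => f [[_ /= fz] /= fy].
  by rewrite -fy in yz.
(* two kernel points near [z]: one of them is not [z] *)
have [y [y' [/near_z[Ky yz] /near_z[Ky' yz'] yy']]] := dominated_kernel_split _ (Kz n).
have [w [Kw wz nwz]] : exists w, [/\ dominated_kernel Z w, mkseq w n = mkseq z n & w <> z].
  have [zy|] := pselect (y = z); last by exists y.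
  by exists y'; split=> // zy'; apply: yy'; rewrite zy.
have /existsNP[i wzi] : ~ forall i, w i = z i by move=> /funext.
exists w, (maxn n i).+1; split=> //; first by rewrite ltnS leq_maxl.
by move=> /eq_mkseqP/(_ i); rewrite ltnS leq_maxr => /(_ isT).
Qed.

(** Limits of a Cantor scheme in the kernel.  A state is a point of the kernel
    together with the length up to which the limit is already decided; either
    branch of the scheme keeps this much and both decide up to a length where
    they differ.  As there are finitely many states at each stage, the limits
    lie below one function. *)
Lemma dominated_perfect Z : ~ dominated Z ->
  exists p : (nat -> bool) -> nat -> nat, [/\ injective p,
    exists g : nat -> nat, forall c i, (p c i <= g i)%N &
    forall c n, exists2 f, Z f & mkseq f n = mkseq (p c) n].
Proof.
move=> ndZ; have [z0 [_ [Kz0 _ _]]] := dominated_kernel_split _ ndZ.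
have /choice[next nextP] : forall st : (nat -> nat) * nat, exists st',
    dominated_kernel Z st.1 -> [/\ dominated_kernel Z st'.1,
      mkseq st'.1 st.2 = mkseq st.1 st.2, (st.2 < st'.2)%N &
      mkseq st'.1 st'.2 <> mkseq st.1 st'.2].
  move=> [z n]; have [/(dominated_kernel_next _ _ n)[z' [n' P]]|nKz] :=
      pselect (dominated_kernel Z z); last by exists (z, n).
  by exists (z', n').
pose step (b : bool) st := (if b then (next st).1 else st.1, (next st).2).
pose run (c : nat -> bool) := fix run k :=
  if k is k'.+1 then step (c k') (run k') else (z0, 0).
have runK c k : dominated_kernel Z (run c k).1.
  by elim: k => //= k IHk; case: (c k) => //=; have [] := nextP _ IHk.
have run_lt c k : ((run c k).2 < (run c k.+1).2)%N by have [] := nextP _ (runK c k).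
have run_ge c k : (k <= (run c k).2)%N.
  by elim: k => // k IHk; exact: leq_ltn_trans (run_lt c k).
have run_mono c k m : (k <= m)%N -> ((run c k).2 <= (run c m).2)%N.
  by move=> /subnK<-; elim: (m - k) => // d IHd; rewrite addSn (leq_trans IHd) // ltnW.
have run_stable c k m : (k <= m)%N ->
    mkseq (run c m).1 (run c k).2 = mkseq (run c k).1 (run c k).2.
  move=> /subnK<-; elim: (m - k) => // d IHd; rewrite addSn -IHd /=.
  case: (c _) => //=; apply: (eq_mkseq_le _ _ _ _ (run_mono c k (d + k) (leq_addl _ _))).
  by have [] := nextP _ (runK c (d + k)).
(* stage [i.+1] decides more than [i] values, see [run_ge] *)
pose p c i := (run c i.+1).1 i.
have pP c k : mkseq (p c) (run c k).2 = mkseq (run c k).1 (run c k).2.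
  apply/eq_mkseqP => i ik; rewrite /p; have [le_ik|le_ki] := leqP i.+1 k.
    by have /eq_mkseqP -> // := run_stable c _ _ le_ik; exact: run_ge.
  by have /eq_mkseqP -> // := run_stable c _ _ (ltnW le_ki).
exists p; split.
- move=> c c' pcc'; apply: contrapT => ncc'.
  have exk : exists k, c k != c' k.
    apply: contrapT => nk; apply: ncc'; apply/funext => k; apply/eqP.
    by apply: contrapT => /negP ck; apply: nk; exists k.
  case: (ex_minnP exk) => k ck kmin.
  have run_eq j : (j <= k)%N -> run c j = run c' j.
    elim: j => //= j IHj jk; rewrite IHj ?(ltnW jk) //; congr (step _ _).
    by apply/eqP; apply: contraTT jk => /kmin; rewrite -leqNgt.
  have [_ _ _] := nextP _ (runK c k); apply.
  have := pP c k.+1; have := pP c' k.+1; rewrite /= -run_eq // pcc' => ->.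
  by case: (c k) (c' k) ck => -[].
- have fin k : exists s : seq ((nat -> nat) * nat), forall c, run c k \in s.
    elim: k => [|k [s sP]]; first by exists [:: (z0, 0)] => c; rewrite inE.
    exists (map (step true) s ++ map (step false) s) => c; rewrite mem_cat /=.
    by case: (c k); rewrite map_f ?orbT.
  have /choice[s sP] := fin.
  exists (fun i => \max_(st <- s i.+1) st.1 i) => c i.
  exact: (@leq_bigmax_seq _ (s i.+1) xpredT (fun st => st.1 i) _ (sP i.+1 c)).
- move=> c n.
  have [f [Zf fn]] :
    Z `&` [set f | mkseq f (run c n).2 = mkseq (run c n).1 (run c n).2] !=set0.
    apply/set0P/eqP => E; apply: (runK c n (run c n).2); rewrite E.
    by exists id.
  by exists f => //; apply: (eq_mkseq_le _ _ _ _ (run_ge c n)); rewrite pP.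
Qed.

(** b is at most the continuum. *)
Lemma not_small_bool_seq : ~ small [set: nat -> bool].
Proof.
move=> sB; apply: not_dominatedT.
have : small [set: nat -> nat]; last by move=> /(_ id); rewrite image_id.
pose code (f : nat -> nat) k :=
  if unpickle k is Some (n, m) then f n == m else false.
apply: (small_inj code); last exact: small_sub sB.
move=> f g _ _ fg; apply/funext => n; apply/eqP.
have := congr1 (fun h => h (pickle (n, g n))) fg.
by rewrite /code pickleK eqxx.
Qed.

(** The complement of the branch depends continuously on the function. *)
Lemma closed_branchC (K : set (powerset_space (seq nat))) (Z : set (nat -> nat)) f :
  closed K -> (forall g, Z g -> K (~` branch g)) ->
  (forall n, exists2 g, Z g & mkseq g n = mkseq f n) -> K (~` branch f).
Proof.
move=> clK ZK Zf; apply: contrapT => nK.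
have [m mP] := open_trace _ _ _ (closed_openC clK) nK.
pose N := \max_(i < m) oapp size 0 (@unpickle (seq nat) i).
have [g Zg gf] := Zf N.
apply: (mP (~` branch g)); last exact: ZK.
apply: eq_trace => i t im it.
have tN : (size t <= N)%N.
  have := leq_bigmax (Ordinal im) (F := fun i : 'I_m => oapp size 0 (@unpickle (seq nat) i)).
  by rewrite [in X in (X <= _)%N](_ : unpickle _ = Some t).
have {}gf := eq_mkseq_le _ _ _ _ tN gf.
by apply/idP/idP => /set_mem nt; apply/mem_set => /branchP tE; apply: nt;
  apply/branchP; rewrite tE size_mkseq ?gf // -gf.
Qed.

Lemma branch_filter_not_Fsigma X : scale X ->
  ~ Fsigma (branch_filter X : set (powerset_space (seq nat))).
Proof.
move=> [ndX smallX] [K clK KE].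
have [n ndn] : exists n, ~ dominated [set f | X f /\ K n (~` branch f)].
  apply: contrapT => nn; apply: ndX.
  apply: (@dominated_sub _ (\bigcup_n [set f | X f /\ K n (~` branch f)])).
    move=> f Xf; have : (branch_filter X : set (powerset_space _)) (~` branch f).
      exact/branch_filterC.
    by rewrite KE => -[n _ Kn]; exists n.
  by apply: dominated_bigcup => n; apply: contrapT => ndn; apply: nn; exists n.
have [p [pinj [g gP] pZ]] := dominated_perfect _ ndn.
have Xp c : X (p c).
  apply/branch_filterC; suff : (\bigcup_n K n) (~` branch (p c)) by rewrite -KE.
  by exists n => //; apply: (closed_branchC _ _ _ (clK n) _ (pZ c)) => f [].
(* every [p c] is below [g], so none is above this [x] *)
have [x Xx nxg] := not_dominated_exists X g ndX.
apply: not_small_bool_seq; apply: (small_inj p); first by move=> c d _ _ /pinj.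
apply: small_sub (smallX x Xx) => _ [c _ <-]; split=> // xp; apply: nxg.
by apply: (eventually_le_trans (p c)) => //; apply: nearW.
Qed.

Theorem corollary3p4 :
  exists (D : Type) (F : set (powerset_space D)),
    [/\ countable [set: D] /\ infinite_set [set: D],
        ProperFilter (F : set_system D) /\ @frechet_filter D `<=` F,
        hurewicz_space (set_type F),
        exists K : set (nat -> nat),
          has_cardinality_b K /\ has_character (F : set_system D) K
      & ~ Fsigma F].
Proof.
have [X [scaleX leX seqX]] := scale_exists.
exists (seq nat), (branch_filter X : set (powerset_space (seq nat))); split.
- split; first exact: countableP.
  apply/infiniteP; apply: (@inj_on_card_le _ _ (mkseq id)) => //.
  by move=> m n _ _ /mkseq_inj.
- split; [exact: branch_filter_proper|exact: frechet_branch_filter].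
- exact: branch_filter_hurewicz.
- exists X; split; last exact: (branch_filter_character _ (proj1 scaleX)).
  by split; [exists X => //; exact: (proj1 scaleX)|exact: leX].
- exact: branch_filter_not_Fsigma.
Qed.
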